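(* Let $m\ge2$ and let $S\subseteq\mathfrak{S}_{m+1}$ be such that each permutation in $S$ is indecomposable and the monotone permutation $(m+1)\cdots21$ does not belong to $S$. Then there exist positive constants $c$, $\lambda$, $r$ with $\lambda>r$ such that $$\frac{\alpha_n(S)}{n!}=c\cdot\lambda^n+O(r^n)\quad\text{as }n\to\infty.$$
   Context: A permutation $\pi\in\mathfrak{S}_n$ is decomposable if there is an index $i$ with $1\le i\le n-1$ such that $\pi(1),\dots,\pi(i)\le i$; otherwise it is indecomposable. For $x\in\mathbb{R}^n$ with distinct coordinates, $\Pi(x)\in\mathfrak{S}_n$ is the permutation with $\pi_i<\pi_j$ if and only if $x_i<x_j$. A permutation $\pi=\pi_1\cdots\pi_n$ avoids $S\subseteq\mathfrak{S}_{m+1}$ if $\Pi(\pi_j,\dots,\pi_{j+m})\notin S$ for all $1\le j\le n-m$. $\alpha_n(S)$ is the number of permutations in $\mathfrak{S}_n$ avoiding $S$. *)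

(* Defs.v *)
From mathcomp Require Import all_boot all_order all_fingroup.

Set Implicit Arguments.
Unset Strict Implicit.
Unset Printing Implicit Defensive.

Import Order.TTheory.

(* Positions and values are numbered from 0 (they are elements of 'I_n), so
   the condition "pi(1), ..., pi(i) <= i" becomes "pi j < i for all j < i". *)
Definition decomposable n (pi : 'S_n) : bool :=
  [exists i : 'I_n, (0 < i) && [forall j : 'I_n, (j < i) ==> (pi j < i)]].

Definition indecomposable n (pi : 'S_n) : bool := ~~ decomposable pi.

(* The value is characterized by PiP and Pi_uniq when x is injective, and is a
   junk value otherwise. *)
Definition Pi d (T : orderType d) n (x : 'I_n -> T) : 'S_n :=
  odflt 1%g
    [pick p : 'S_n | [forall i, forall j, (p i < p j) == (x i < x j)%O]].

Lemma order_perm_exists d (T : orderType d) n (x : 'I_n -> T) :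
  injective x -> exists p : 'S_n, forall i j, (p i < p j) = (x i < x j)%O.
Proof.
move=> xI; pose A i := [set k | (x k < x i)%O].
have Alt i : #|A i| < n.
  rewrite -[X in _ < X](card_ord n) -cardsT proper_card // properE subsetT /=.
  by apply/subsetPn; exists i; rewrite ?inE ?ltxx.
pose f i : 'I_n := Ordinal (Alt i).
have mono i j : (x i < x j)%O -> f i < f j.
  move=> lt_ij; rewrite /= proper_card // properE; apply/andP; split.
    by apply/subsetP => k; rewrite !inE => /lt_trans; apply.
  by apply/subsetPn; exists i; rewrite !inE ?ltxx.
have fE i j : (f i < f j) = (x i < x j)%O.
  apply/idP/idP; last exact: mono.
  case: (ltgtP (x i) (x j)) => // [/mono lt_ji lt_ij|/xI->]; last by rewrite ltnn.
  by have := ltn_trans lt_ij lt_ji; rewrite ltnn.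
have fI : injective f.
  move=> i j eq_f; apply: xI.
  by case: (ltgtP (x i) (x j)) => //; rewrite -fE eq_f ltnn.
by exists (perm fI) => i j; rewrite !permE fE.
Qed.

Lemma PiP d (T : orderType d) n (x : 'I_n -> T) :
  injective x -> forall i j, (Pi x i < Pi x j) = (x i < x j)%O.
Proof.
move=> /order_perm_exists[p pP] i j; rewrite /Pi; case: pickP => [q|/(_ p)] /=.
  by move=> /forallP/(_ i)/forallP/(_ j)/eqP.
by move=> /negP[]; apply/forallP => a; apply/forallP => b; rewrite pP.
Qed.

Lemma Pi_uniq d (T : orderType d) n (x : 'I_n -> T) (p : 'S_n) :
  (forall i j, (p i < p j) = (x i < x j)%O) -> Pi x = p.
Proof.
move=> pP; have xI : injective x.
  move=> i j eq_x; apply: (@perm_inj _ p); apply/val_inj/eqP.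
  by rewrite eqn_leq leqNgt pP [X in _ && X]leqNgt pP eq_x ltxx.
have rankE (q : 'S_n) i : val (q i) = #|[set k | q k < q i]|.
  transitivity #|[set k : 'I_n | k < q i]|.
    have qi_le : q i <= n by exact: ltnW.
    transitivity (\sum_(k < q i) 1).
      by rewrite sum_nat_const card_ord muln1.
    by rewrite (big_ord_widen _ (fun=> 1) qi_le) sum1dep_card.
  rewrite -(card_imset _ (@perm_inj _ q)); apply: eq_card => k.
  rewrite inE; apply/idP/imsetP => [lt_k|[l]]; last by rewrite inE => ? ->.
  by exists (q^-1 k)%g; rewrite ?inE permKV.
apply/permP => i; apply/val_inj; rewrite rankE [RHS]rankE.
by apply: eq_card => k; rewrite !inE (PiP xI) pP.
Qed.

Lemma window_subproof n m (j : 'I_(n - m)) (i : 'I_m.+1) : j + i < n.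
Proof.
have := ltn_ord j; rewrite ltn_subRL addnC; apply: leq_ltn_trans.
by rewrite leq_add2l -ltnS.
Qed.

Definition window n m (pi : 'S_n) (j : 'I_(n - m)) (i : 'I_m.+1) : 'I_n :=
  pi (Ordinal (window_subproof j i)).

(* 'I_(n - m) is empty when n <= m: such permutations vacuously avoid S. *)
Definition avoids n m (S : {set 'S_m.+1}) (pi : 'S_n) : bool :=
  [forall j : 'I_(n - m), Pi (window pi j) \notin S].

Definition alpha n m (S : {set 'S_m.+1}) : nat :=
  #|[set pi : 'S_n | avoids S pi]|.

Definition decreasing_perm n : 'S_n := perm (@rev_ord_inj n).

(* Main.v *)
Require Import Defs.
From mathcomp Require Import all_boot all_order all_fingroup all_algebra.
From mathcomp Require Import zify.

(* Replace permutations of [n] by words of length [n] over a large finite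
   alphabet: the proportion of words avoiding [S] tends to
   [a_n = alpha_n / n!] as the alphabet grows. Since every pattern of [S] is
   indecomposable, no occurrence straddles a cut, a position where [m] letters
   below a fixed level are followed by [m] letters above it, and two words may
   exchange their tails at such cuts. Exchanging tails between words of lengths
   [n + 2] and [n] at cuts shifted by one gives two words of length [n + 1], so
   [a_(n+2) a_n] and [a_(n+1)^2] differ by at most the proportion of pairs
   without a common cut. A descending window is never forbidden, so a block can
   be refilled by descending through the top letters, then through the bottom
   ones, and once more: this creates a cut, is allowed as soon as the letters
   around the block are not extreme, and has a probability bounded below.
   Hence pairs without a common cut are exponentially rarer than all pairs of
   avoiding words, and [ln a_n] has geometrically small second differences. *)

Set Implicit Arguments.
Unset Strict Implicit.
Unset Printing Implicit Defensive.

Import Order.TTheory.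

(** * Pairs of words without a common cut *)

Section Words.

Variables (m N : nat) (S : {set 'S_m.+1}).

Local Notation letter := 'I_N.+1.
Local Notation word n := {ffun 'I_n -> letter}.

(* Positions beyond the end of the word carry the letter 0. *)
Definition ev n (x : word n) (i : nat) : letter := oapp x ord0 (insub i).

Definition word_of n (f : nat -> letter) : word n := [ffun i : 'I_n => f i].

Lemma ev_ord n (x : word n) (i : 'I_n) : ev x i = x i.
Proof. by rewrite /ev valK. Qed.

Lemma ev_word_of n f i : i < n -> ev (word_of n f) i = f i.
Proof. by move=> lt_in; rewrite -[i]/(val (Ordinal lt_in)) ev_ord ffunE. Qed.

Lemma word_eqP n (x y : word n) : (forall i, i < n -> ev x i = ev y i) -> x = y.
Proof. by move=> eq_xy; apply/ffunP => i; rewrite -!ev_ord eq_xy. Qed.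

(* A window with a repeated letter matches no pattern. *)
Definition matches (f : nat -> letter) j (s : 'S_m.+1) : bool :=
  [forall i, forall k, (s i < s k) == (f (j + i) < f (j + k))].

Definition free_at (f : nat -> letter) j : bool :=
  ~~ [exists s in S, matches f j s].

Definition valid n (f : nat -> letter) : bool :=
  [forall j : 'I_(n - m), free_at f j].

Lemma validP n f :
  reflect (forall j, j + m < n -> free_at f j) (valid n f).
Proof.
apply: (iffP forallP) => [fS j lt_j|fS j]; last first.
  by apply: fS; have := ltn_ord j; lia.
have lt_j' : j < n - m by lia.
exact: (fS (Ordinal lt_j')).
Qed.

Lemma free_at_eq (f g : nat -> letter) j j' :
  (forall i, i <= m -> f (j + i) = g (j' + i)) -> free_at f j = free_at g j'.
Proof.
move=> eq_fg; congr (~~ _); apply: eq_existsb => s; congr (_ && _).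
by apply: eq_forallb => i; apply: eq_forallb => k; rewrite !eq_fg // -ltnS.
Qed.

(** * Windows that match no pattern *)

Hypothesis indecS : forall s, s \in S -> indecomposable s.
Hypothesis decrS : decreasing_perm m.+1 \notin S.

(** The [m.+1 - k] values at positions from [k] on all exceed [s a], which leaves room only for
    [s a < k]. *)
Lemma perm_cut_decomposable (s : 'S_m.+1) k :
  0 < k <= m -> (forall a b : 'I_m.+1, a < k <= b -> s a < s b) ->
  decomposable s.
Proof.
move=> /andP[k_gt0 le_km] s_lt.
have lt_km : k < m.+1 by [].
apply/existsP; exists (Ordinal lt_km); rewrite /= k_gt0 /=.
apply/forallP => a; apply/implyP => lt_ak.
have sub : [set s b | b : 'I_m.+1 & k <= b] \subset [set v : 'I_m.+1 | s a < v].
  by apply/subsetP => v /imsetP[b]; rewrite inE => le_kb ->; rewrite inE s_lt ?lt_ak.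
have := subset_leq_card sub; rewrite card_imset; last exact: perm_inj.
have cardge (c : nat) : c <= m.+1 -> #|[set b : 'I_m.+1 | c <= b]| = m.+1 - c.
  move=> le_c; have := cardsC [set b : 'I_m.+1 | b < c].
  rewrite card_ord => cE.
  have -> : [set b : 'I_m.+1 | c <= b] = ~: [set b : 'I_m.+1 | b < c].
    by apply/setP => b; rewrite !inE leqNgt.
  suff : #|[set b : 'I_m.+1 | b < c]| = c by lia.
  rewrite -sum1dep_card -(big_ord_widen _ (fun=> 1) le_c).
  by rewrite sum_nat_const card_ord muln1.
by rewrite !cardge ?ltn_ord ?(ltnW lt_km) //; have := ltn_ord (s a); lia.
Qed.

(** A pattern matching this window would inherit the low-high split at [t - j] and so be
    decomposable. All uses of indecomposability go through here. *)
Lemma free_at_up (f : nat -> letter) j t : j < t <= j + m ->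
  (forall a b, j <= a < t -> t <= b <= j + m -> f a < f b) -> free_at f j.
Proof.
move=> /andP[lt_jt le_tj] f_lt; apply/existsP => -[s /andP[sS /forallP sM]].
have /negP := indecS sS; apply; apply: (@perm_cut_decomposable s (t - j)); first lia.
move=> a b /andP[lt_a le_b]; have /forallP/(_ b)/eqP-> := sM a.
by apply: f_lt; have := ltn_ord b; lia.
Qed.

(** A match would have the relative order of [rev_ord], hence be [decreasing_perm] by [Pi_uniq]. *)
Lemma free_at_down (f : nat -> letter) j :
  (forall a b, j <= a -> a < b -> b <= j + m -> f b < f a) -> free_at f j.
Proof.
move=> f_lt; apply/existsP => -[s /andP[sS /forallP sM]].
have mono (i k : 'I_m.+1) : (s i < s k) = (rev_ord i < rev_ord k).
  have /forallP/(_ k)/eqP-> := sM i; have := ltn_ord i; have := ltn_ord k.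
  rewrite /= !subSS; case: (ltngtP i k) => [lt_ik|lt_ki|/val_inj->] lt_k lt_i.
  - have := f_lt (j + i) (j + k); lia.
  - have := f_lt (j + k) (j + i); lia.
  - by lia.
have sE : s = Pi (@rev_ord m.+1) by apply/esym/Pi_uniq.
suff dE : decreasing_perm m.+1 = Pi (@rev_ord m.+1).
  by rewrite sE -dE (negPf decrS) in sS.
by apply/esym/Pi_uniq => i k; rewrite !permE.
Qed.


Lemma valid_eq n (f g : nat -> letter) :
  (forall i, i < n -> f i = g i) -> valid n f = valid n g.
Proof.
move=> eq_fg; apply: eq_forallb => j; apply: free_at_eq => i le_im.
by apply: eq_fg; have := ltn_ord j; lia.
Qed.

Hypothesis m_gt0 : 0 < m.

(* Letters are grouped into cells of [M] consecutive ones; [v %/ M] is the cell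
   of [v]. *)
Lemma ltn_cell M v w : v %/ M < w %/ M -> v < w.
Proof. by rewrite !ltnNge; apply: contra => /leq_div2r->. Qed.

(* With [q >= 2 * m] cells, runs of [m] letters descend alternately through the
   [m] top cells and through the [m] bottom cells. *)
Definition zigzag q k : nat :=
  if odd (k %/ m) then m.-1 - k %% m else q.-1 - k %% m.

Lemma zigzag_block q a k :
  k < m -> zigzag q (a * m + k) = if odd a then m.-1 - k else q.-1 - k.
Proof.
move=> lt_km.
by rewrite /zigzag divnMDl // modnMDl divn_small // modn_small // addn0.
Qed.

(** A window of [m.+1] letters meets exactly two consecutive runs. Bottom then top is a low-high
    split; top then bottom descends throughout, since [2 * m <= q] keeps the top and bottom cells
    apart. *)
Lemma zigzag_free q M (f : nat -> letter) p L j :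
  2 * m <= q -> (forall k, k < L -> f (p + k) %/ M = zigzag q k) ->
  p <= j -> j + m < p + L -> free_at f j.
Proof.
move=> le_q fE le_pj lt_jL.
have [a [r [jE lt_rm]]] : exists a r, j - p = a * m + r /\ r < m.
  by exists ((j - p) %/ m), ((j - p) %% m); rewrite -divn_eq ltn_mod.
have cell_of b k : k < m -> p <= b -> b <= j + m ->
    b - p = a * m + k -> f b %/ M = if odd a then m.-1 - k else q.-1 - k.
  move=> lt_k le_pb le_b bE; rewrite -(subnKC le_pb) fE; last lia.
  by rewrite bE zigzag_block.
have cell_of' b k : k < m -> p <= b -> b <= j + m ->
    b - p = a.+1 * m + k -> f b %/ M = if odd a then q.-1 - k else m.-1 - k.
  move=> lt_k le_pb le_b bE; rewrite -(subnKC le_pb) fE; last lia.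
  rewrite bE zigzag_block //=.
  by case: (odd a).
have bE b : j <= b -> b < j + (m - r) -> exists2 k, k < m & b - p = a * m + k.
  by move=> *; exists (b - j + r); lia.
have bE' b : j + (m - r) <= b -> b <= j + m -> exists2 k, k < m & b - p = a.+1 * m + k.
  by move=> *; exists (b - j - (m - r)); lia.
case odd_a : (odd a) cell_of cell_of' => cell_of cell_of'.
  apply: (@free_at_up _ _ (j + (m - r))); first lia.
  move=> b b' /andP[le_jb lt_b] /andP[le_b' le_b'j]; apply: (@ltn_cell M).
  have [k lt_k kE] := bE b le_jb lt_b; rewrite (cell_of b k) //; try lia.
  have [k' lt_k' k'E] := bE' b' le_b' le_b'j; rewrite (cell_of' b' k') //; lia.
apply: free_at_down => b b' le_jb lt_bb' le_b'; apply: (@ltn_cell M).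
case: (ltnP b' (j + (m - r))) => le_jb'.
  have [|k lt_k kE] := bE b le_jb; first lia.
  have [|k' lt_k' k'E] := bE b' _ le_jb'; first lia.
  by rewrite (cell_of b k) ?(cell_of b' k') //; lia.
have [k' lt_k' k'E] := bE' b' le_jb' le_b'; rewrite (cell_of' b' k') //; try lia.
case: (ltnP b (j + (m - r))) => le_jb''.
  have [k lt_k kE] := bE b le_jb le_jb''.
  by rewrite (cell_of b k) //; lia.
have [|k lt_k kE] := bE' b le_jb''; first lia.
by rewrite (cell_of' b k) //; lia.
Qed.

Definition patch p L (g f : nat -> letter) i : letter :=
  if p <= i < p + L then g (i - p) else f i.

(** The refill opens with a top run and closes with a bottom run, while the [m] letters on either
    side lie in neither kind of cell. A window across either border is therefore a low-high split,
    and one inside the refill is handled by [zigzag_free]. *)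
Lemma patch_valid q M n p (f g : nat -> letter) :
  2 * m <= q -> m <= p -> p + 5 * m <= n ->
  (forall k, k < 4 * m -> g k %/ M = zigzag q k) ->
  (forall i, p - m <= i < p -> m <= f i %/ M < q - m) ->
  (forall i, p + 4 * m <= i < p + 5 * m -> m <= f i %/ M < q - m) ->
  valid n f -> valid n (patch p (4 * m) g f).
Proof.
move=> le_q le_mp le_pn gE fL fR /validP fS; apply/validP => j lt_jn.
case: (ltnP (j + m) p) => [lt_jp|le_pj].
  rewrite (@free_at_eq _ f j j) ?fS // => i le_im.
  by rewrite /patch ifN //; lia.
case: (leqP (p + 4 * m) j) => [le_j|lt_j].
  rewrite (@free_at_eq _ f j j) ?fS // => i le_im.
  by rewrite /patch ifN //; lia.
have in_patch i : p <= i < p + 4 * m ->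
    patch p (4 * m) g f i %/ M = zigzag q (i - p).
  by move=> lt_i; rewrite /patch lt_i gE //; lia.
have out_patch i : ~~ (p <= i < p + 4 * m) -> patch p (4 * m) g f i = f i.
  by rewrite /patch => /negPf->.
case: (ltnP j p) => [lt_jp|le_pj'].
  apply: (@free_at_up _ _ p); first lia.
  move=> a b lt_a le_b; apply: (@ltn_cell M).
  rewrite out_patch; last lia.
  rewrite in_patch; last lia.
  rewrite -[b - p]/(0 * m + (b - p)) zigzag_block; last lia.
  by have /andP[_] : m <= f a %/ M < q - m; [apply: fL; lia|rewrite /=; lia].
case: (ltnP (j + m) (p + 4 * m)) => [lt_jm|le_jm].
  apply: (@zigzag_free q M _ p (4 * m)) => // k lt_k.
  by rewrite in_patch ?addKn //; lia.
apply: (@free_at_up _ _ (p + 4 * m)); first lia.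
move=> a b lt_a le_b; apply: (@ltn_cell M).
rewrite (out_patch b); last lia.
rewrite in_patch; last lia.
have -> : a - p = 3 * m + (a - p - 3 * m) by lia.
rewrite zigzag_block /=; last lia.
by have /andP[] : m <= f b %/ M < q - m; [apply: fR; lia|lia].
Qed.

(** * Cuts and the exchange of tails *)

Variable M : nat.

(** As a length, [m] makes every window across [t] see only controlled letters; as a level, it
    separates the bottom cells of [zigzag] from the others. *)
Definition cut (f : nat -> letter) t : bool :=
  (m <= t) && [forall k : 'I_m, f (t - k.+1) %/ M < m <= f (t + k) %/ M].

Lemma cutP (f : nat -> letter) t : reflect
  [/\ m <= t, forall i, t - m <= i < t -> f i %/ M < m &
      forall i, t <= i < t + m -> m <= f i %/ M] (cut f t).
Proof.
apply: (iffP andP) => [[le_mt /forallP fc]|[le_mt fl fh]]; last first.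
  split=> //; apply/forallP => k; have := ltn_ord k => lt_k.
  by rewrite fl ?fh //; lia.
split=> // i lt_i.
  have lt_k : t - i.+1 < m by lia.
  have /andP[+ _] := fc (Ordinal lt_k); rewrite /=.
  by have -> : t - (t - i.+1).+1 = i by lia.
have lt_k : i - t < m by lia.
have /andP[_] := fc (Ordinal lt_k); rewrite /=.
by have -> : t + (i - t) = i by lia.
Qed.

Definition valid_pair a b (w : word a.+1 * word b) : bool :=
  valid a.+1 (ev w.1) && valid b (ev w.2).

(* The first word is cut one position later than the second, so that exchanging
   the tails of words of lengths [a + 1] and [b] gives lengths [b + 1] and [a]. *)
Definition matched a b (w : word a.+1 * word b) t : bool :=
  [&& t + m <= a, t + m <= b, cut (ev w.1) t.+1 & cut (ev w.2) t].

Definition swap a b t (w : word a.+1 * word b) : word b.+1 * word a :=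
  (word_of b.+1 (fun i => if i <= t then ev w.1 i else ev w.2 i.-1),
   word_of a (fun i => if i < t then ev w.2 i else ev w.1 i.+1)).

(** A window on one side of the exchange comes from one of the old words; a window across it has low
    letters of one word followed by high letters of the other, at the same level. *)
Lemma swap_valid a b t (w : word a.+1 * word b) :
  matched w t -> valid_pair w -> valid_pair (swap t w).
Proof.
case: w => x y /and4P[le_ta le_tb /cutP[_ xl xh] /cutP[_ yl yh]].
case/andP => /validP xS /validP yS; rewrite /= in xl xh yl yh xS yS *.
apply/andP; split; apply/validP => j lt_j; rewrite /swap /=.
  case: (ltnP t (j + m)) => [lt_t|le_t]; last first.
    rewrite (@free_at_eq _ (ev x) j j) ?xS //; first lia.
    by move=> i le_i; rewrite ev_word_of ?ifT //; lia.
  case: (ltnP t j) => [lt_tj|le_jt].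
    rewrite (@free_at_eq _ (ev y) j j.-1) ?yS //; first lia.
    move=> i le_i; rewrite ev_word_of ?ifF //; try lia.
    by congr (ev y _); lia.
  apply: (@free_at_up _ _ t.+1); first lia.
  move=> c d lt_c lt_d; apply: (@ltn_cell M).
  rewrite !ev_word_of; try lia.
  rewrite ifT; last lia.
  rewrite ifF; last lia.
  by apply: leq_trans (xl _ _) (yh _ _); lia.
case: (ltnP (j + m) t) => [lt_jt|le_tj].
  rewrite (@free_at_eq _ (ev y) j j) ?yS //; first lia.
  by move=> i le_i; rewrite ev_word_of ?ifT //; lia.
case: (leqP t j) => [lt_tj|lt_jt].
  rewrite (@free_at_eq _ (ev x) j j.+1); first by apply: xS; lia.
  by move=> i le_i; rewrite ev_word_of ?ifF //; lia.
apply: (@free_at_up _ _ t); first lia.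
move=> c d lt_c lt_d; apply: (@ltn_cell M).
rewrite !ev_word_of; try lia.
rewrite ifT; last lia.
rewrite ifF; last lia.
by apply: leq_trans (yl _ _) (xh _ _); lia.
Qed.

Lemma swap_matched a b t (w : word a.+1 * word b) :
  matched w t -> matched (swap t w) t.
Proof.
case: w => x y /and4P[le_ta le_tb /cutP[mx xl xh] /cutP[my yl yh]].
rewrite /= in mx xl xh my yl yh *.
apply/and4P; split=> //; apply/cutP; split=> //= i lt_i.
- by rewrite ev_word_of ?ifT ?xl //; lia.
- by rewrite ev_word_of ?ifF ?yh //; lia.
- by rewrite ev_word_of ?ifT ?yl //; lia.
- by rewrite ev_word_of ?ifF ?xh //; lia.
Qed.

(* Two matched positions are at distance at least [m], hence swapping the tails
   at the first one creates none before it. *)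
Lemma swap_first a b t t' (w : word a.+1 * word b) :
  matched w t -> t' < t -> matched (swap t w) t' -> matched w t'.
Proof.
case: w => x y /and4P[le_ta le_tb /cutP[mx xl xh] /cutP[my yl yh]] lt_t.
rewrite /= in mx xl xh my yl yh *.
case/and4P => le_t'a le_t'b /cutP[mx' xl' xh'] /cutP[my' yl' yh'].
rewrite /= in mx' xl' xh' my' yl' yh' *.
case: (leqP (t' + m) t) => [le_t'|lt_t'].
  apply/and4P; split; rewrite /=; try lia; apply/cutP; split=> //= i lt_i.
  - by have := xl' i lt_i; rewrite ev_word_of ?ifT //; lia.
  - by have := xh' i lt_i; rewrite ev_word_of ?ifT //; lia.
  - by have := yl' i lt_i; rewrite ev_word_of ?ifT //; lia.
  - by have := yh' i lt_i; rewrite ev_word_of ?ifT //; lia.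
have /xh' : t'.+1 <= t'.+1 < t'.+1 + m by lia.
rewrite ev_word_of ?ifT; try lia.
by have /xl : t.+1 - m <= t'.+1 < t.+1; lia.
Qed.

Lemma swap_inj a b t : t <= a -> t <= b -> injective (@swap a b t).
Proof.
move=> le_ta le_tb [x y] [x' y'] eq_w.
have eq1 i : i < b.+1 -> (if i <= t then ev x i else ev y i.-1) =
                         (if i <= t then ev x' i else ev y' i.-1).
  move=> lt_i; have /(congr1 (fun w => ev w.1 i)) := eq_w.
  by rewrite /= !ev_word_of.
have eq2 i : i < a -> (if i < t then ev y i else ev x i.+1) =
                      (if i < t then ev y' i else ev x' i.+1).
  move=> lt_i; have /(congr1 (fun w => ev w.2 i)) := eq_w.
  by rewrite /= !ev_word_of.
congr pair; apply: word_eqP => i lt_i.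
  case: (leqP i t) => [le_it|lt_ti]; first by have := eq1 i; rewrite le_it; apply; lia.
  have := eq2 i.-1; rewrite ifF ?prednK //; try lia.
  by rewrite ifF; [apply; lia | lia].
case: (ltnP i t) => [lt_it|le_ti]; first by have := eq2 i; rewrite lt_it; apply; lia.
have := eq1 i.+1; rewrite ifF /=; last lia.
by rewrite ifF; [apply; lia | lia].
Qed.

Definition has_match a b (w : word a.+1 * word b) : bool :=
  has (matched w) (iota 0 a).

Definition first_match a b (w : word a.+1 * word b) : nat :=
  find (matched w) (iota 0 a).

Lemma has_matchP a b (w : word a.+1 * word b) :
  reflect (exists t, matched w t) (has_match w).
Proof.
apply: (iffP hasP) => [[t _ wt]|[t wt]]; exists t => //.
by rewrite mem_iota; case/and4P: wt => *; lia.
Qed.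

Lemma first_matchP a b (w : word a.+1 * word b) :
  has_match w ->
  matched w (first_match w) /\ forall t, t < first_match w -> ~~ matched w t.
Proof.
move=> wM; have := wM; rewrite /has_match has_find size_iota => lt_f.
split=> [|t lt_t].
  by have := nth_find 0 wM; rewrite nth_iota.
by have := before_find 0 lt_t; rewrite nth_iota ?add0n => [->|]//;
  exact: ltn_trans lt_f.
Qed.

Lemma first_match_uniq a b (w : word a.+1 * word b) t :
  matched w t -> (forall t', t' < t -> ~~ matched w t') -> first_match w = t.
Proof.
move=> wt t_min; have /first_matchP[wf f_min] : has_match w.
  by apply/has_matchP; exists t.
case: (ltngtP (first_match w) t) => // [/t_min|/f_min]; last by rewrite wt.
by rewrite wf.
Qed.

(** Exchanging at the first match keeps that match first, so its position can be read off the image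
    and the exchange undone. *)
Lemma card_matched_le a b :
  #|[set w : word a.+1 * word b | valid_pair w && has_match w]| <=
  #|[set w : word b.+1 * word a | valid_pair w && has_match w]|.
Proof.
pose sw (w : word a.+1 * word b) := swap (first_match w) w.
have swP w : has_match w ->
    matched (sw w) (first_match w) /\ first_match (sw w) = first_match w.
  case/first_matchP => wf f_min; have swf := swap_matched wf; split=> //.
  by apply: first_match_uniq => // t lt_t; 
  apply: contra (f_min t lt_t); exact: swap_first.
rewrite -(card_in_imset (f := sw)); last first.
  move=> w w'; rewrite !inE => /andP[_ wM] /andP[_ wM'] eq_sw.
  have eq_f : first_match w = first_match w'.
    by rewrite -(swP w wM).2 -(swP w' wM').2 eq_sw.
  have /and4P[le_a le_b _ _] := (first_matchP wM).1.
  by move: eq_sw; rewrite /sw -eq_f; apply: swap_inj; lia.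
apply/subset_leq_card/subsetP => _ /imsetP[w wP ->]; move: wP; rewrite !inE.
case/andP => wS wM; rewrite swap_valid ?(first_matchP wM).1 //=.
by apply/has_matchP; exists (first_match w); exact: (swP w wM).1.
Qed.

Definition num_valid n := #|[set x : word n | valid n (ev x)]|.

Definition unmatched_pairs a b : {set word a.+1 * word b} :=
  [set w | valid_pair w && ~~ has_match w].

Lemma card_valid_pair a b :
  #|[set w : word a.+1 * word b | valid_pair w]| = num_valid a.+1 * num_valid b.
Proof.
rewrite -cardsX; apply: eq_card => -[x y].
by rewrite !inE.
Qed.

Lemma num_valid_swap a b :
  num_valid a.+1 * num_valid b <=
  num_valid b.+1 * num_valid a + #|unmatched_pairs a b|.
Proof.
rewrite -!card_valid_pair.
rewrite -(cardsID [set w | has_match w]) leq_add //.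
  apply: leq_trans (leq_trans (card_matched_le a b) _); apply: subset_leq_card.
    by apply/subsetP => w; rewrite !inE.
  by apply/subsetP => w; rewrite !inE => /andP[].
by apply/subset_leq_card/subsetP => w; rewrite !inE andbC.
Qed.


(** * Counting words cell by cell *)

Lemma card_cell q M0 c :
  N.+1 = q * M0 -> c < q -> #|[set v : letter | v %/ M0 == c]| = M0.
Proof.
move=> NE lt_cq; have M_gt0 : 0 < M0 by case: M0 NE => //; rewrite muln0.
pose f (u : 'I_M0) : letter := inord (c * M0 + u).
have fE u : f u = c * M0 + u :> nat.
  by rewrite inordK // NE; have := ltn_ord u; nia.
have f_inj : injective f.
  by move=> u u' /(congr1 (@nat_of_ord _)); rewrite !fE => /addnI/val_inj.
rewrite -[RHS]card_ord -cardsT -(card_imset _ f_inj); apply: eq_card => v.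
rewrite !inE; apply/eqP/imsetP => [vc|[u _ ->]]; last first.
  by rewrite fE divnMDl // divn_small ?addn0.
exists (Ordinal (ltn_pmod v M_gt0)) => //; apply: val_inj.
by rewrite /= fE /= -vc -divn_eq.
Qed.

Lemma card_box q M0 n (F : nat -> nat) :
  N.+1 = q * M0 -> (forall i, F i < q) ->
  #|[set x : word n | [forall i, x i %/ M0 == F i]]| = M0 ^ n.
Proof.
move=> NE lt_Fq; pose A (i : 'I_n) := mem [set v : letter | v %/ M0 == F i].
transitivity #|family A|.
  by apply: eq_card => x; rewrite inE; apply: eq_forallb => i; rewrite /= inE.
rewrite card_family foldrE big_map big_enum /=.
rewrite (eq_bigr (fun=> M0)) => [|i _]; last exact: card_cell NE _.
by rewrite prod_nat_const card_ord.
Qed.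

(** * Refilling blocks *)

Variable q : nat.
Hypothesis le_q : 2 * m <= q.
Hypothesis NE : N.+1 = q * M.

Lemma ltn_zigzag i : zigzag q i < q.
Proof. by rewrite /zigzag; case: odd; lia. Qed.

(** Such a letter lies below the top run that opens a refill and above the bottom run that closes
    it. *)
Definition mid (v : letter) : bool := m <= v %/ M < q - m.

(* A block has [6 * m] positions, of which the middle [4 * m] are to be refilled;
   as in [matched], it is read one position later in the first word. *)
Definition good a b (w : word a.+1 * word b) k : bool :=
  [forall r : 'I_(6 * m), ((r < m) || (5 * m <= r)) ==>
     mid (ev w.1 (k * (6 * m) + r).+1) && mid (ev w.2 (k * (6 * m) + r))].

Definition has_gadget a b (w : word a.+1 * word b) k : bool :=
  [forall r : 'I_(4 * m),
     (ev w.1 (k * (6 * m) + (m + r)).+1 %/ M == zigzag q r) &&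
     (ev w.2 (k * (6 * m) + (m + r)) %/ M == zigzag q r)].

Definition gadgets : {set word (4 * m) * word (4 * m)} :=
  [set g : word (4 * m) * word (4 * m) |
     [forall r, g.1 r %/ M == zigzag q r] &&
     [forall r, g.2 r %/ M == zigzag q r]].

Lemma card_gadgets : #|gadgets| = M ^ (8 * m).
Proof.
have -> : 8 * m = 4 * m + 4 * m by lia.
rewrite expnD -!(card_box _ NE ltn_zigzag) -cardsX; apply: eq_card => -[g g'].
by rewrite !inE.
Qed.

Definition insert a b k (g : word (4 * m) * word (4 * m))
    (w : word a.+1 * word b) : word a.+1 * word b :=
  (word_of a.+1 (patch (k * (6 * m) + m).+1 (4 * m) (ev g.1) (ev w.1)),
   word_of b (patch (k * (6 * m) + m) (4 * m) (ev g.2) (ev w.2))).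

Lemma in_block k k' r : r < 6 * m ->
  (k * (6 * m) + m <= k' * (6 * m) + r < k * (6 * m) + m + 4 * m) =
  (k' == k) && (m <= r < 5 * m).
Proof.
move=> lt_r; case: (ltngtP k' k) => [lt_k|lt_k|->] /=; last by lia.
  have : k'.+1 * (6 * m) <= k * (6 * m) by rewrite leq_mul2r lt_k orbT.
  by lia.
have : k.+1 * (6 * m) <= k' * (6 * m) by rewrite leq_mul2r lt_k orbT.
by lia.
Qed.

Section Resampling.

Variables (a b B : nat).
Hypothesis le_Ba : B * (6 * m) <= a.
Hypothesis le_Bb : B * (6 * m) <= b.

Implicit Types (w : word a.+1 * word b) (g : word (4 * m) * word (4 * m)).

Lemma block_bound k r : k < B -> r < 6 * m -> k * (6 * m) + r < B * (6 * m).
Proof.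
move=> lt_k lt_r; have : k.+1 * (6 * m) <= B * (6 * m) by rewrite leq_mul2r lt_k orbT.
lia.
Qed.

Lemma insert1 k g w k' r : k' < B -> r < 6 * m ->
  ev (insert k g w).1 (k' * (6 * m) + r).+1 =
  if (k' == k) && (m <= r < 5 * m) then ev g.1 (r - m)
  else ev w.1 (k' * (6 * m) + r).+1.
Proof.
move=> lt_k lt_r; have lt_i := block_bound lt_k lt_r.
rewrite ev_word_of; last lia.
rewrite /patch !addSn ltnS -(in_block _ _ lt_r) subSS ltnS.
case: ifP => // /[dup] lt_kr; rewrite in_block // => /andP[/eqP-> lt_mr].
by congr (ev _ _); lia.
Qed.

Lemma insert2 k g w k' r : k' < B -> r < 6 * m ->
  ev (insert k g w).2 (k' * (6 * m) + r) =
  if (k' == k) && (m <= r < 5 * m) then ev g.2 (r - m)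
  else ev w.2 (k' * (6 * m) + r).
Proof.
move=> lt_k lt_r; have lt_i := block_bound lt_k lt_r.
rewrite ev_word_of; last lia.
rewrite /patch -(in_block _ _ lt_r).
case: ifP => // /[dup] lt_kr; rewrite in_block // => /andP[/eqP-> lt_mr].
by congr (ev _ _); lia.
Qed.

(** Being good depends only on the margins of a block, which a refill leaves alone; hence refilling
    preserves the set of good blocks. *)
Lemma insert_good k g w k' : k' < B -> good (insert k g w) k' = good w k'.
Proof.
move=> lt_k; apply: eq_forallb => r; have lt_r := ltn_ord r.
apply: implyb_id2l => rP; rewrite insert1 // insert2 //.
by rewrite !ifN //; lia.
Qed.

Lemma insert_gadget k g w k' : k' < B -> k' != k ->
  has_gadget (insert k g w) k' = has_gadget w k'.
Proof.
move=> lt_k ne_k; apply: eq_forallb => r; have lt_r := ltn_ord r.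
by rewrite insert1 ?insert2 ?(negPf ne_k) //; lia.
Qed.

Lemma has_gadget_insert k g w : k < B -> g \in gadgets -> has_gadget (insert k g w) k.
Proof.
move=> lt_k; rewrite inE => /andP[/forallP g1 /forallP g2].
apply/forallP => r; have lt_r := ltn_ord r.
rewrite insert1 ?insert2 ?eqxx ?ifT //=; try lia.
by rewrite addKn !ev_ord g1 g2.
Qed.

Lemma insert_valid k g w : k < B -> g \in gadgets -> good w k ->
  valid_pair w -> valid_pair (insert k g w).
Proof.
move=> lt_k; rewrite inE => /andP[/forallP g1 /forallP g2] /forallP wG.
have lt_kB : k * (6 * m) + 6 * m <= B * (6 * m).
  by rewrite addnC -mulSn leq_mul2r lt_k orbT.
have {}wG r : r < 6 * m -> (r < m) || (5 * m <= r) ->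
    mid (ev w.1 (k * (6 * m) + r).+1) && mid (ev w.2 (k * (6 * m) + r)).
  by move=> lt_r rP; have := wG (Ordinal lt_r); rewrite /= rP.
case/andP => w1 w2; apply/andP; split.
  rewrite (@valid_eq _ _ (patch (k * (6 * m) + m).+1 (4 * m) (ev g.1) (ev w.1)));
    last by move=> i; apply: ev_word_of.
  apply: (@patch_valid q M) => //; try lia.
  - by move=> i lt_i; rewrite -[i]/(val (Ordinal lt_i)) ev_ord (eqP (g1 _)).
  - move=> i lt_i; have /andP[+ _] := wG (i.-1 - k * (6 * m)) ltac:(lia) ltac:(lia).
    by rewrite /mid; have -> : (k * (6 * m) + (i.-1 - k * (6 * m))).+1 = i by lia.
  - move=> i lt_i; have /andP[+ _] := wG (i.-1 - k * (6 * m)) ltac:(lia) ltac:(lia).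
    by rewrite /mid; have -> : (k * (6 * m) + (i.-1 - k * (6 * m))).+1 = i by lia.
rewrite (@valid_eq _ _ (patch (k * (6 * m) + m) (4 * m) (ev g.2) (ev w.2)));
  last by move=> i; apply: ev_word_of.
apply: (@patch_valid q M) => //; try lia.
- by move=> i lt_i; rewrite -[i]/(val (Ordinal lt_i)) ev_ord (eqP (g2 _)).
- move=> i lt_i; have /andP[_] := wG (i - k * (6 * m)) ltac:(lia) ltac:(lia).
  by rewrite /mid; have -> : k * (6 * m) + (i - k * (6 * m)) = i by lia.
- move=> i lt_i; have /andP[_] := wG (i - k * (6 * m)) ltac:(lia) ltac:(lia).
  by rewrite /mid; have -> : k * (6 * m) + (i - k * (6 * m)) = i by lia.
Qed.

(** The second run of a gadget is a bottom run and the third a top run, so a common cut sits after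
    the margin and two runs, at offset [3 * m] in the block. *)
Lemma has_gadget_match w k : k < B -> has_gadget w k -> has_match w.
Proof.
move=> lt_k /forallP wG; have lt_kB : k * (6 * m) + 6 * m <= B * (6 * m).
  by rewrite addnC -mulSn leq_mul2r lt_k orbT.
have wG' c r : c < 4 -> r < m ->
    let v := if odd c then m.-1 - r else q.-1 - r in
    (ev w.1 (k * (6 * m) + (m + (c * m + r))).+1 %/ M = v) *
    (ev w.2 (k * (6 * m) + (m + (c * m + r))) %/ M = v).
  move=> lt_c lt_r v; have lt_cr : c * m + r < 4 * m by nia.
  have /andP[/eqP e1 /eqP e2] := wG (Ordinal lt_cr).
  by rewrite /= in e1 e2; rewrite e1 e2 zigzag_block.
apply/has_matchP; exists (k * (6 * m) + 3 * m).
apply/and4P; split; try lia; apply/cutP; split; try lia; move=> i lt_i.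
- have := wG' 1 (i.-1 - (k * (6 * m) + 2 * m)) isT ltac:(lia).
  rewrite /= (_ : (_ + (m + (1 * m + _))).+1 = i); last lia.
  by move=> [-> _]; lia.
- have := wG' 2 (i.-1 - (k * (6 * m) + 3 * m)) isT ltac:(lia).
  rewrite /= (_ : (_ + (m + (2 * m + _))).+1 = i); last lia.
  by move=> [-> _]; lia.
- have := wG' 1 (i - (k * (6 * m) + 2 * m)) isT ltac:(lia).
  rewrite /= (_ : _ + (m + (1 * m + _)) = i); last lia.
  by move=> [_ ->]; lia.
- have := wG' 2 (i - (k * (6 * m) + 3 * m)) isT ltac:(lia).
  rewrite /= (_ : _ + (m + (2 * m + _)) = i); last lia.
  by move=> [_ ->]; lia.
Qed.

Definition good_set w : {set 'I_B} := [set k : 'I_B | good w k].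

(** Fixing the good set makes every block of [J] refillable throughout the class; [j] then lets the
    blocks be treated one at a time. *)
Definition gadget_free_below (J : {set 'I_B}) j : {set word a.+1 * word b} :=
  [set w | [&& valid_pair w, good_set w == J &
            [forall k : 'I_B, (k \in J) && (k < j) ==> ~~ has_gadget w k]]].

(** Writing a gadget into block [j] while recording the letters it erases is injective, from [V]
    times the [M ^ (8 * m)] gadgets to [G] times the [N.+1 ^ (8 * m)] possible contents. As
    [N.+1 = q * M], at least one pair in [q ^ (8 * m)] of [V] has a gadget at [j]. *)
Lemma gadget_free_step (J : {set 'I_B}) (j : 'I_B) : j \in J ->
  #|gadget_free_below J j.+1| * q ^ (8 * m) <=
  (q ^ (8 * m)).-1 * #|gadget_free_below J j|.
Proof.
move=> jJ; set V := gadget_free_below J j.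
pose G := V :&: [set w | has_gadget w j].
have VE : #|V| = #|G| + #|gadget_free_below J j.+1|.
  rewrite -(cardsID [set w | has_gadget w j]); congr (_ + _).
  apply: eq_card => w; rewrite !inE; case: (valid_pair w) => /=; last by rewrite andbF.
  case: eqP => [eqJ|] /=; last by rewrite andbF.
  apply/andP/forallP => [[wj /forallP wV] k|wV].
    apply/implyP => /andP[kJ]; rewrite ltnS leq_eqVlt => /orP[/eqP/val_inj->//|lt_k].
    by have := wV k; rewrite kJ lt_k.
  split; first by have := wV j; rewrite jJ ltnSn.
  apply/forallP => k; apply/implyP => /andP[kJ /ltnW le_k].
  by have := wV k; rewrite kJ ltnS le_k.
suff leG : #|V| <= #|G| * q ^ (8 * m).
  have Q_gt0 : 0 < q ^ (8 * m) by rewrite expn_gt0; lia.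
  by move: leG Q_gt0; rewrite VE; set Q := q ^ (8 * m); nia.
pose p := j * (6 * m) + m.
pose cutout w : word (4 * m) * word (4 * m) :=
  (word_of (4 * m) (fun r => ev w.1 (p + r).+1),
   word_of (4 * m) (fun r => ev w.2 (p + r))).
pose resample (u : _ * (word (4 * m) * word (4 * m))) := (insert j u.2 u.1, cutout u.1).
have Dp1 i : i < a.+1 -> ~~ (p.+1 <= i < p.+1 + 4 * m) ->
    forall g w, ev (insert j g w).1 i = ev w.1 i.
  by move=> lt_i out g w; rewrite ev_word_of // /patch (negPf out).
have Dp2 i : i < b -> ~~ (p <= i < p + 4 * m) ->
    forall g w, ev (insert j g w).2 i = ev w.2 i.
  by move=> lt_i out g w; rewrite ev_word_of // /patch (negPf out).
have lt_p : p + 5 * m <= B * (6 * m).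
  have := @block_bound j (6 * m).-1 (ltn_ord j); rewrite /p; lia.
have res_inj : injective resample.
  move=> [w g] [w' g'] eq_r; pose u := insert j g w.
  have eq_u : u = insert j g' w' := congr1 fst eq_r.
  have c1 : (cutout w).1 = (cutout w').1 := congr1 (fun v => v.2.1) eq_r.
  have c2 : (cutout w).2 = (cutout w').2 := congr1 (fun v => v.2.2) eq_r.
  congr pair.
    rewrite [w]surjective_pairing [w']surjective_pairing; congr pair.
      apply: word_eqP => i lt_i; case: (boolP (p.+1 <= i < p.+1 + 4 * m)) => i_p.
        have := congr1 (fun x => ev x (i - p.+1)) c1; rewrite !ev_word_of; try lia.
        by rewrite -addSn subnKC; [|lia].
      by rewrite -(Dp1 i lt_i i_p g w) -(Dp1 i lt_i i_p g' w') -/u eq_u.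
    apply: word_eqP => i lt_i; case: (boolP (p <= i < p + 4 * m)) => i_p.
      have := congr1 (fun x => ev x (i - p)) c2; rewrite !ev_word_of; try lia.
      by rewrite subnKC; [|lia].
    by rewrite -(Dp2 i lt_i i_p g w) -(Dp2 i lt_i i_p g' w') -/u eq_u.
  have evg r : r < 4 * m -> (ev g.1 r = ev u.1 (j * (6 * m) + (m + r)).+1) *
                             (ev g.2 r = ev u.2 (j * (6 * m) + (m + r))).
    by move=> lt_r; rewrite insert1 ?insert2 ?eqxx ?ifT ?addKn //; lia.
  have evg' r : r < 4 * m -> (ev g'.1 r = ev u.1 (j * (6 * m) + (m + r)).+1) *
                             (ev g'.2 r = ev u.2 (j * (6 * m) + (m + r))).
    by move=> lt_r; rewrite eq_u insert1 ?insert2 ?eqxx ?ifT ?addKn //; lia.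
  rewrite [g]surjective_pairing [g']surjective_pairing.
  by congr pair; apply: word_eqP => r lt_r; rewrite evg // evg'.
have : #|resample @: setX V gadgets| <= #|setX G [set: word (4 * m) * word (4 * m)]|.
  apply/subset_leq_card/subsetP => _ /imsetP[[w g] /setXP[wV gG] ->].
  move: wV; rewrite !inE /= andbT => /and3P[wS /eqP wJ /forallP wV].
  have gj : good w j by rewrite -wJ inE in jJ.
  rewrite insert_valid //= has_gadget_insert // andbT; apply/andP; split.
    by rewrite -wJ; apply/eqP/setP => k; rewrite !inE insert_good.
  apply/forallP => k; apply/implyP => /[dup] kV /andP[_ lt_k].
  rewrite insert_gadget //; first by have := wV k; rewrite kV.
  by apply: contraTneq lt_k => ->; rewrite ltnn.
rewrite card_imset // !cardsX card_gadgets cardsT card_prod !card_ffun !card_ord -expnD.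
have -> : 4 * m + 4 * m = 8 * m by lia.
have -> : N.+1 ^ (8 * m) = q ^ (8 * m) * M ^ (8 * m) by rewrite NE expnMn.
by rewrite mulnA leq_pmul2r // expn_gt0; case: M NE => //; rewrite muln0.
Qed.

(** Each block of [J] contributes a factor [Q.-1 / Q]; the factors of the [#|J| - h] surplus blocks
    are bounded by 1. *)
Lemma gadget_free_le (J : {set 'I_B}) h : h <= #|J| ->
  #|gadget_free_below J B| * (q ^ (8 * m)) ^ h <=
  (q ^ (8 * m)).-1 ^ h * #|gadget_free_below J 0|.
Proof.
set Q := q ^ (8 * m); have Q_gt0 : 0 < Q by rewrite expn_gt0; lia.
have step j : j <= B ->
    #|gadget_free_below J j| * Q ^ #|[set k in J | k < j]| <=
    Q.-1 ^ #|[set k in J | k < j]| * #|gadget_free_below J 0|.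
  elim: j => [|j IHj] lt_jB.
    have -> : [set k in J | k < 0] = set0 by apply/setP => k; rewrite !inE andbF.
    by rewrite cards0 !expn0 muln1 mul1n.
  pose j' := Ordinal lt_jB; case: (boolP (j' \in J)) => jJ.
    have -> : #|[set k in J | k < j.+1]| = #|[set k in J | k < j]|.+1.
      have -> : [set k in J | k < j.+1] = j' |: [set k in J | k < j].
        apply/setP => k; rewrite !inE ltnS leq_eqVlt.
        have -> : (k == j') = (k == j :> nat) by [].
        case: eqP => [kj|_] /=; last by [].
        have -> : k = j' by exact: val_inj.
        by rewrite jJ.
      by rewrite cardsU1 !inE ltnn andbF.
    have le1 := gadget_free_step jJ; rewrite -/Q /= in le1.
    have le2 := IHj (ltnW lt_jB); rewrite !expnS.
    rewrite mulnA; apply: leq_trans (leq_mul le1 (leqnn _)) _.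
    by rewrite -!mulnA leq_mul2l le2 orbT.
  have -> : [set k in J | k < j.+1] = [set k in J | k < j].
    apply/setP => k; rewrite !inE ltnS leq_eqVlt andb_orr.
    case: eqP => [kj|_] /=; last by rewrite andbF.
    have -> : k = j' by exact: val_inj.
    by rewrite (negPf jJ).
  apply: leq_trans (IHj (ltnW lt_jB)); rewrite leq_mul2r; apply/orP; right.
  apply/subset_leq_card/subsetP => w; rewrite !inE => /and3P[-> -> /forallP wV].
  apply/forallP => k; apply/implyP => /andP[kJ /ltnW lt_k].
  by have := wV k; rewrite kJ ltnS lt_k.
move=> le_h; have := step B (leqnn B).
have -> : [set k in J | k < B] = J by apply/setP => k; rewrite !inE ltn_ord andbT.
rewrite -(subnK le_h); move: (#|J| - h) => e; rewrite !expnD => le_B.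
have Qe_gt0 : 0 < Q ^ e by rewrite expn_gt0 Q_gt0.
rewrite -(leq_pmul2l Qe_gt0) mulnCA; apply: leq_trans le_B _.
rewrite -mulnA leq_mul2r; apply/orP; right.
by case: e {Qe_gt0} => // e; rewrite leq_exp2r ?leq_pred.
Qed.

(** After sorting the pairs by their good set [J], an unmatched pair has no gadget in any block,
    because a gadget would provide a match. *)
Lemma card_unmatched_good h :
  #|[set w in unmatched_pairs a b | h <= #|good_set w| ]| * (q ^ (8 * m)) ^ h <=
  (q ^ (8 * m)).-1 ^ h * (num_valid a.+1 * num_valid b).
Proof.
rewrite -card_valid_pair -!sum1_card.
rewrite (partition_big good_set predT) //=.
rewrite [X in _ <= _ * X](partition_big good_set predT) //=.
rewrite big_distrl big_distrr /=; apply: leq_sum => J _.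
case: (leqP h #|J|) => [le_h|lt_h]; last first.
  rewrite big_pred0 ?mul0n // => w; rewrite inE.
  case: eqP => [->|]; last by rewrite andbF.
  by rewrite leqNgt lt_h !andbF.
rewrite !sum1_card; apply: leq_trans (leq_trans (gadget_free_le le_h) _); last first.
  rewrite leq_mul2l; apply/orP; right; apply/subset_leq_card/subsetP => w.
  by rewrite !inE => /and3P[wS wJ _]; rewrite unfold_in /= inE wS.
rewrite leq_mul2r; apply/orP; right; apply/subset_leq_card/subsetP => w.
rewrite unfold_in /= !inE => /andP[/andP[/andP[wS wM] _] wJ]; rewrite wS wJ /=.
apply/forallP => k; apply/implyP => _; apply: contra wM.
exact: has_gadget_match.
Qed.

Definition num_extreme n (x : word n) := #|[set i | ~~ mid (x i)]|.

(** Sending each extreme letter to the index of its block reaches every bad block; the predecessor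
    in [s1] undoes the shift by one in the first word. *)
Lemma card_bad_blocks w :
  #|~: good_set w| <= num_extreme w.1 + num_extreme w.2.
Proof.
pose s1 := [seq (nat_of_ord i).-1 %/ (6 * m) | i in [set i | ~~ mid (w.1 i)]].
pose s2 := [seq nat_of_ord i %/ (6 * m) | i in [set i | ~~ mid (w.2 i)]].
have -> : num_extreme w.1 + num_extreme w.2 = size (s1 ++ s2).
  by rewrite size_cat !size_map -!cardE.
rewrite cardE -(size_map val); apply: uniq_leq_size.
  by rewrite map_inj_uniq ?enum_uniq //; exact: val_inj.
move=> _ /mapP[k + ->]; rewrite mem_enum !inE => /forallPn[r].
have lt_r := ltn_ord r; have lt_i := block_bound (ltn_ord k) lt_r.
rewrite negb_imply negb_and => /andP[_ /orP bad]; rewrite mem_cat; apply/orP.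
case: bad => bad; [left|right]; apply/mapP.
  have lt_ia : (k * (6 * m) + r).+1 < a.+1 by lia.
  exists (Ordinal lt_ia); first by rewrite mem_enum inE -ev_ord.
  by rewrite /= divnMDl ?divn_small ?addn0 //; lia.
have lt_ib : k * (6 * m) + r < b by lia.
exists (Ordinal lt_ib); first by rewrite mem_enum inE -ev_ord.
by rewrite /= divnMDl ?divn_small ?addn0 //; lia.
Qed.

End Resampling.

(** * Rarity of extreme letters *)

Variable l : nat.
Hypothesis l_gt0 : 0 < l.
Hypothesis qE : q = 2 * m * l.

Lemma card_extreme : #|[set v : letter | ~~ mid v]| <= 2 * m * M.
Proof.
have -> : 2 * m * M = size (iota 0 (m * M) ++ iota ((q - m) * M) (m * M)).
  by rewrite size_cat !size_iota; lia.
have M_gt0 : 0 < M by case: M NE => //; rewrite muln0.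
rewrite cardE -(size_map val); apply: uniq_leq_size.
  by rewrite map_inj_uniq ?enum_uniq //; exact: val_inj.
move=> _ /mapP[v + ->]; rewrite mem_enum inE negb_and -ltnNge -leqNgt.
rewrite mem_cat !mem_iota add0n leq0n /= ltn_divLR // leq_divRL //.
case/orP => [->//|->]; apply/orP; right => /=.
by rewrite -mulnDl subnK -?NE ?ltn_ord //; lia.
Qed.

(** The sum factors over positions. In each factor the ordinary letters contribute at most [N.+1],
    and so do the extreme ones: they make up at most a share [1 / l] of the alphabet and have weight
    [l]. *)
Lemma sum_exp_extreme n :
  \sum_(x : word n) l ^ num_extreme x <= (2 * N.+1) ^ n.
Proof.
pose F (i : 'I_n) (v : letter) := if mid v then 1 else l.
have <- : \prod_(i < n) \sum_v F i v = \sum_(x : word n) l ^ num_extreme x.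
  rewrite bigA_distr_bigA; apply: eq_bigr => x _.
  rewrite -prod_nat_const [RHS]big_mkcond; apply: eq_bigr => i _.
  by rewrite inE /F; case: mid.
rewrite -[n in X in _ <= X]card_ord -prod_nat_const; apply: leq_prod => i _.
rewrite (bigID mid) /= (eq_bigr (fun=> 1)) => [|v]; last by rewrite /F => ->.
rewrite [X in _ + X](eq_bigr (fun=> l)) => [|v]; last by rewrite /F => /negPf->.
rewrite sum1_card sum_nat_const mul2n -addnn leq_add //.
  by rewrite -[N.+1 in X in _ <= X]card_ord max_card.
have := card_extreme; rewrite cardsE => le_ext.
apply: leq_trans (leq_mul le_ext (leqnn l)) _.
by rewrite [X in _ <= X]NE qE; lia.
Qed.

(** This is Markov's inequality for the weight [l ^ num_extreme]: [h] bad blocks force at least [h]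
    extreme letters in the two words together. *)
Lemma card_few_good a b B h : B * (6 * m) <= a -> B * (6 * m) <= b ->
  #|[set w : word a.+1 * word b | h <= B - #|good_set B w| ]| * l ^ h <=
  (2 * N.+1) ^ (a.+1 + b).
Proof.
move=> le_Ba le_Bb; rewrite expnD.
apply: leq_trans (leq_mul (sum_exp_extreme _) (sum_exp_extreme _)).
rewrite big_distrlr /= pair_bigA /= -sum1_card big_distrl /= big_mkcond /=.
apply: leq_sum => w _; rewrite inE; case: ifP => // le_h.
rewrite mul1n -expnD leq_pexp2l //; apply: leq_trans le_h _.
apply: leq_trans (card_bad_blocks le_Ba le_Bb w).
have := cardsC (good_set B w); rewrite card_ord => cE; by rewrite leq_subLR cE.
Qed.

(** Regrouping the letters into only [2 * m] cells of size [l * M], every word that follows the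
    zigzag of these cells is valid. *)
Lemma num_valid_zigzag n : (l * M) ^ n <= num_valid n.
Proof.
have NE' : N.+1 = 2 * m * (l * M) by rewrite NE qE; lia.
have lt_z i : zigzag (2 * m) i < 2 * m by rewrite /zigzag; case: odd; lia.
rewrite -(card_box _ NE' lt_z); apply/subset_leq_card/subsetP => x.
rewrite !inE => /forallP xz; apply/validP => j lt_j.
apply: (@zigzag_free (2 * m) (l * M) _ 0 n) => // k lt_k.
by rewrite -[0 + k]/(nat_of_ord (Ordinal lt_k)) ev_ord (eqP (xz _)).
Qed.

(* [U] counts the unmatched pairs with at least [h] good blocks out of [2 * h],
   [V] the pairs with at least [h] blocks that are not good. *)
Lemma num_valid_almost_swap a b h :
  2 * h * (6 * m) <= a -> 2 * h * (6 * m) <= b ->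
  exists U V, [/\ num_valid a.+1 * num_valid b <=
                    num_valid b.+1 * num_valid a + (U + V),
    U * (q ^ (8 * m)) ^ h <=
      (q ^ (8 * m)).-1 ^ h * (num_valid a.+1 * num_valid b) &
    V * l ^ h <= (2 * N.+1) ^ (a.+1 + b)].
Proof.
move=> le_ha le_hb.
exists #|[set w in unmatched_pairs a b | h <= #|good_set (2 * h) w| ]|.
exists #|[set w : word a.+1 * word b | h <= 2 * h - #|good_set (2 * h) w| ]|.
split; [|exact: card_unmatched_good|exact: card_few_good].
apply: leq_trans (num_valid_swap a b) _; rewrite leq_add2l.
apply: leq_trans (leq_card_setU _ _); apply/subset_leq_card/subsetP => w wU.
by rewrite !inE; rewrite inE in wU; rewrite wU /=; lia.
Qed.

End Words.

(** * Words and permutations *)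

Section OrderTypes.

Variables (m N n : nat) (S : {set 'S_m.+1}).
Local Notation word := {ffun 'I_n -> 'I_N.+1}.

Definition order_type (x : word) : 'S_n := Pi (fun i => x i : nat).

Lemma order_typeP (x : word) : injective x ->
  forall i k, (order_type x i < order_type x k) = (x i < x k).
Proof.
move=> x_inj i k; rewrite /order_type PiP ?ltEnat //.
by move=> i' k' /val_inj/x_inj.
Qed.

Lemma order_type_eq (x : word) (p : 'S_n) :
  (forall i k, (p i < p k) = (x i < x k)) -> order_type x = p.
Proof. by move=> pP; apply: Pi_uniq => i k; rewrite ltEnat pP. Qed.

Lemma valid_order_type (x : word) :
  injective x -> valid S n (ev x) = avoids S (order_type x).
Proof.
move=> x_inj; apply: eq_forallb => j; congr (~~ _).
have w_inj : injective (window (order_type x) j).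
  by move=> i k /perm_inj/(congr1 val) /= /addnI/val_inj.
have evE (i : 'I_m.+1) : ev x (j + i) = x (Ordinal (window_subproof j i)).
  by rewrite -ev_ord.
have ltE i k : (window (order_type x) j i < window (order_type x) j k)%O =
    (ev x (j + i) < ev x (j + k)).
  by rewrite ltEord order_typeP // !evE.
apply/existsP/idP => [[s /andP[sS /forallP sM]]|wS].
  suff -> : Pi (window (order_type x) j) = s by [].
  by apply: Pi_uniq => i k; have /forallP/(_ k)/eqP-> := sM i; rewrite ltE.
exists (Pi (window (order_type x) j)); rewrite wS /=.
by apply/forallP => i; apply/forallP => k; rewrite PiP // ltE.
Qed.

(** Injectivity excludes the words on which [Pi] may take its junk value. *)
Definition of_type (p : 'S_n) : {set word} :=
  [set x : word | injectiveb x && (order_type x == p)].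

(** Permuting the positions of a word carries any order type to any other. *)
Lemma card_of_type p : #|of_type p| = #|of_type 1|.
Proof.
pose act (s : 'S_n) (x : word) : word := [ffun i => x (s i)].
have act_inj s : injective (act s).
  move=> x y /ffunP eq_xy; apply/ffunP => i.
  by have := eq_xy (s^-1 i)%g; rewrite !ffunE permKV.
have actP s p1 x : x \in of_type p1 -> act s x \in of_type (s * p1).
  rewrite !inE => /andP[/injectiveP x_inj /eqP <-]; apply/andP; split.
    by apply/injectiveP => i k; rewrite !ffunE => /x_inj/perm_inj.
  by apply/eqP/order_type_eq => i k; rewrite !ffunE !permM order_typeP.
apply/eqP; rewrite eqn_leq; apply/andP; split.
  rewrite -(card_imset _ (act_inj p^-1%g)); apply/subset_leq_card/subsetP.
  by move=> _ /imsetP[x xp ->]; rewrite -(mulVg p) actP.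
rewrite -(card_imset _ (act_inj p)); apply/subset_leq_card/subsetP.
by move=> _ /imsetP[x xp ->]; rewrite -[p in of_type p]mulg1 actP.
Qed.

Lemma card_injective_valid :
  #|[set x : word | injectiveb x && valid S n (ev x)]| * n`! =
  alpha n S * N.+1 ^_ n.
Proof.
have -> : #|[set x : word | injectiveb x && valid S n (ev x)]| =
    alpha n S * #|of_type 1|.
  rewrite -sum1_card (partition_big order_type (avoids S)) /=.
    rewrite -sum_nat_cond_const; apply: eq_bigr => p pS.
    rewrite -(card_of_type p) -sum1_card; apply: eq_bigl => x; rewrite !inE.
    case: (boolP (injectiveb x)) => //= /injectiveP x_inj.
    by rewrite valid_order_type //; case: eqP => [->|]; rewrite ?pS ?andbF.
  by move=> x; rewrite !inE => /andP[/injectiveP x_inj]; rewrite valid_order_type.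
have -> : N.+1 ^_ n = n`! * #|of_type 1|.
  have := card_inj_ffuns 'I_n 'I_N.+1; rewrite !card_ord => <-.
  rewrite -card_Sn -sum1_card (partition_big order_type predT) //=.
  rewrite -[RHS]sum_nat_const; apply: eq_bigr => p _.
  by rewrite -(card_of_type p) -sum1_card; apply: eq_bigl => x; rewrite !inE.
by rewrite mulnA mulnAC.
Qed.

(* The words with a repeated letter are the only source of error. *)
Lemma num_valid_alpha :
  alpha n S * N.+1 ^_ n <= num_valid N S n * n`! <=
  alpha n S * N.+1 ^_ n + n`! * (N.+1 ^ n - N.+1 ^_ n).
Proof.
have le_inj : #|[set x : word | ~~ injectiveb x]| = N.+1 ^ n - N.+1 ^_ n.
  have := card_inj_ffuns 'I_n 'I_N.+1; rewrite !card_ord => <-.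
  have := cardsC [set x : word | injectiveb x].
  rewrite card_ffun !card_ord => <-; rewrite addKn.
  by apply: eq_card => x; rewrite !inE.
rewrite -card_injective_valid leq_mul2r; apply/andP; split.
  by apply/orP; right; apply/subset_leq_card/subsetP => x; rewrite !inE => /andP[].
rewrite -le_inj [n`! * _]mulnC -mulnDl leq_mul2r; apply/orP; right.
apply: leq_trans (leq_card_setU _ _); apply/subset_leq_card/subsetP => x.
by rewrite !inE => ->; rewrite andbT orbN.
Qed.

End OrderTypes.

(** * Sequences with nearly linear logarithm *)

From mathcomp Require Import all_classical all_reals all_analysis.
From mathcomp Require Import ring lra.

Import GRing.Theory Num.Theory numFieldNormedType.Exports.
Local Open Scope classical_set_scope.
Local Open Scope ring_scope.

Section Asymptotics.

Variable R : realType.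

(** With [K = C / (1 - t)], the tail of the geometric series is [K * t ^+ n]; subtracting it from
    [w] gives a nondecreasing sequence and adding it a nonincreasing one, and these enclose the
    limit. *)
Lemma geometric_cauchy (w : nat -> R) (C t : R) n0 :
  0 <= C -> 0 < t < 1 ->
  (forall n, (n0 <= n)%N -> `|w n.+1 - w n| <= C * t ^+ n) ->
  exists L C', 0 <= C' /\ forall n, (n0 <= n)%N -> `|w n - L| <= C' * t ^+ n.
Proof.
move=> C_ge0 /andP[t_gt0 t_lt1] dw.
have t1_gt0 : 0 < 1 - t by lra.
pose K := C / (1 - t); have K_ge0 : 0 <= K by rewrite divr_ge0 // ltW.
have KE : C = K * (1 - t) by rewrite /K mulfVK ?gt_eqF.
have {}dw n : (n0 <= n)%N -> `|w n.+1 - w n| <= K * t ^+ n - K * t ^+ n.+1.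
  by move=> /dw; rewrite KE exprS; set x := t ^+ n; lra.
pose lo n := w (n0 + n)%N - K * t ^+ (n0 + n).
pose up n := w (n0 + n)%N + K * t ^+ (n0 + n).
have lo_nd : nondecreasing_seq lo.
  apply/nondecreasing_seqP => n; rewrite /lo addnS.
  have := dw (n0 + n)%N (leq_addr _ _); rewrite ler_norml => /andP[+ _].
  lra.
have up_ni : nonincreasing_seq up.
  apply/nonincreasing_seqP => n; rewrite /up addnS.
  have := dw (n0 + n)%N (leq_addr _ _); rewrite ler_norml => /andP[_].
  lra.
have e_ge0 n : 0 <= K * t ^+ n by rewrite mulr_ge0 // exprn_ge0 // ltW.
have lo_up k n : lo k <= up n.
  apply: (le_trans (lo_nd _ _ (leq_maxl k n))).
  apply: (le_trans _ (up_ni _ _ (leq_maxr k n))).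
  by rewrite /lo /up; have := e_ge0 (n0 + maxn k n)%N; lra.
have lo_cvg : cvgn lo.
  apply: nondecreasing_is_cvgn => //; exists (up 0%N) => _ [k _ <-]; exact: lo_up.
exists (limn lo), K; split=> // n le_n; rewrite -(subnKC le_n).
rewrite ler_norml; apply/andP; split.
  have : limn lo <= up (n - n0)%N.
    by apply: limr_le => //; apply: nearW => k; apply: lo_up.
  by rewrite /up; lra.
have := nondecreasing_cvgn_le lo_nd lo_cvg (n - n0)%N.
by rewrite /lo; lra.
Qed.

(** For [e <= 1/2] one has [1 <= (1 - e) * (1 + 2 * e)], so [x * (1 - e) <= y] gives
    [x <= y * expR (2 * e)]. *)
Lemma ln_ratio_le (x y e : R) :
  0 < x -> 0 < y -> 0 <= e <= 2^-1 -> x <= y + e * x -> ln x - ln y <= 2 * e.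
Proof.
move=> x_gt0 y_gt0 /andP[e_ge0 e_le] le_xy.
have : x <= y * expR (2 * e).
  apply: (@le_trans _ _ (y * (1 + 2 * e))); last by rewrite ler_pM2l // expR_ge1Dx.
  have : 0 <= x * (e * (1 - 2 * e)) by rewrite !mulr_ge0 ?(ltW x_gt0) //; lra.
  have : 0 <= (y - (x - e * x)) * (1 + 2 * e) by rewrite mulr_ge0 //; lra.
  lra.
rewrite -ler_ln ?posrE ?mulr_gt0 ?expR_gt0 // lnM ?posrE ?expR_gt0 // expRK.
lra.
Qed.

Lemma expR_sub1_le (d C : R) : `|d| <= C -> `|expR d - 1| <= expR C * `|d|.
Proof.
move=> d_le; have C_ge1 : 1 <= expR C.
  by rewrite -expR0 ler_expR; apply: le_trans d_le.
case: (lerP 0 d) => [d_ge0|d_lt0].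
  have := expR_ge1Dx d; have := expR_ge1Dx (- d).
  rewrite expRN => le1 le2; rewrite ger0_norm; last lra.
  have {}le1 : expR d * (1 - d) <= 1.
    by rewrite -ler_pdivlMl ?expR_gt0 // mulr1.
  rewrite ger0_norm // in d_le *.
  have : expR d <= expR C by rewrite ler_expR.
  nra.
have : expR d <= 1 by rewrite -expR0 ler_expR ltW.
have := expR_ge1Dx d => le1 le2; rewrite ler0_norm; last lra.
rewrite ltr0_norm // in d_le *; nra.
Qed.

(** The logarithm of [s] is summed twice by [geometric_cauchy]: its increments [D] converge to [al],
    the logarithm of [lambda], and then [ln (s n) - al * n] converges to [be], the logarithm of
    [c]. *)
Lemma log_linear_asymptotics (s : nat -> R) (C t : R) :
  0 <= C -> 0 < t < 1 -> (forall n, 0 < s n) ->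
  (forall n, s n.+2 * s n <= s n.+1 ^+ 2 + C * t ^+ n * (s n.+2 * s n)) ->
  (forall n, s n.+1 ^+ 2 <= s n.+2 * s n + C * t ^+ n * s n.+1 ^+ 2) ->
  exists c lambda : R, [/\ 0 < c, 0 < lambda &
    exists n0 K, forall n, (n0 <= n)%N ->
      `|s n - c * lambda ^+ n| <= K * (lambda * t) ^+ n].
Proof.
move=> C_ge0 t01 s_gt0 le1 le2; have /andP[t_gt0 t_lt1] := t01.
have tn_ge0 n : 0 <= t ^+ n by rewrite exprn_ge0 // ltW.
have [n0 small] : exists n0, forall n, (n0 <= n)%N -> C * t ^+ n <= 2^-1.
  have : (fun n => C * t ^+ n) @ \oo --> (C * 0).
    by apply: cvgMr; apply: cvg_expr; rewrite ger0_norm // ltW.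
  rewrite mulr0 => /cvgrPdist_le/(_ 2^-1 ltac:(lra)) [n0 _ le_n0].
  exists n0 => n /le_n0; rewrite sub0r normrN ger0_norm //.
  exact: mulr_ge0.
pose D n := ln (s n.+1) - ln (s n).
have dD n : (n0 <= n)%N -> `|D n.+1 - D n| <= (2 * C) * t ^+ n.
  move=> /small Cn.
  have {}Cn : 0 <= C * t ^+ n <= 2^-1 by rewrite Cn mulr_ge0.
  have p1 : 0 < s n.+2 * s n by rewrite mulr_gt0.
  have p2 : 0 < s n.+1 ^+ 2 by rewrite exprn_gt0.
  have h1 := ln_ratio_le p1 p2 Cn (le1 n).
  have h2 := ln_ratio_le p2 p1 Cn (le2 n).
  rewrite lnM ?posrE // expr2 lnM ?posrE // in h1 h2.
  by rewrite /D ler_norml; apply/andP; split; lra.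
have C2_ge0 : 0 <= 2 * C by rewrite mulr_ge0.
have [al [C1 [C1_ge0 Dal]]] := geometric_cauchy C2_ge0 t01 dD.
pose w n := ln (s n) - al * n%:R.
have dw n : (n0 <= n)%N -> `|w n.+1 - w n| <= C1 * t ^+ n.
  have -> : w n.+1 - w n = D n - al by rewrite /w /D -natr1; ring.
  exact: Dal.
have [be [C2 [C2_pos wbe]]] := geometric_cauchy C1_ge0 t01 dw.
exists (expR be), (expR al); split; rewrite ?expR_gt0 //.
exists n0, (expR be * (expR C2 * C2)) => n le_n.
have sE : s n = expR be * expR al ^+ n * expR (w n - be).
  rewrite -expRM_natl -!expRD -[LHS]lnK ?posrE //; congr expR; rewrite /w; ring.
rewrite sE -[X in _ - X]mulr1 -mulrBr normrM ger0_norm; last first.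
  by rewrite mulr_ge0 ?exprn_ge0 ?expR_ge0.
have d_le := wbe n le_n.
have d_le' : `|w n - be| <= C2.
  by apply: (le_trans d_le); rewrite ler_piMr // exprn_ile1 // ?ltW.
have -> : expR be * (expR C2 * C2) * (expR al * t) ^+ n =
    expR be * expR al ^+ n * (expR C2 * (C2 * t ^+ n)) by rewrite exprMn; ring.
rewrite ler_pM2l ?mulr_gt0 ?exprn_gt0 ?expR_gt0 //.
by apply: le_trans (expR_sub1_le d_le') _; rewrite ler_pM2l ?expR_gt0.
Qed.

Lemma expr_divn_le (c : R) K :
  0 <= c < 1 -> (0 < K)%N ->
  exists C t, [/\ 0 <= C, 0 < t < 1 & forall n, c ^+ (n %/ K) <= C * t ^+ n].
Proof.
move=> /andP[c_ge0 c_lt1] K_gt0.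
have K_gt0' : 0 < K%:R :> R by rewrite ltr0n.
have K_ge1 : 1 <= K%:R :> R by rewrite ler1n.
(* Bernoulli's inequality gives [c <= (1 - d) ^+ K]. Halving [1 - c] keeps [1 - d] positive even for
   [c = 0]; the constant [(1 - d) ^- K] absorbs the incomplete last group of [n]. *)
pose d := (1 - c) / 2 / K%:R.
have d_gt0 : 0 < d by rewrite !divr_gt0 //; lra.
have dK : d * K%:R = (1 - c) / 2 by rewrite /d mulfVK // gt_eqF.
have d_lt1 : d < 1 by nra.
exists ((1 - d) ^- K), (1 - d); split; [by rewrite invr_ge0 exprn_ge0 //; lra|lra|].
have le_c : c <= (1 - d) ^+ K.
  have bern n : 1 - d * n%:R <= (1 - d) ^+ n.
    elim: n => [|n IHn]; first by rewrite expr0; lra.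
    rewrite exprS -natr1; have n_ge0 : 0 <= n%:R :> R by [].
    have : (1 - d) * (1 - d * n%:R) <= (1 - d) * (1 - d) ^+ n.
      by rewrite ler_pM2l //; lra.
    by apply: le_trans; nra.
  by apply: le_trans (bern K); rewrite dK; lra.
move=> n; rewrite mulrC ler_pdivlMr ?exprn_gt0 //; last lra.
have -> : (1 - d) ^+ n = (1 - d) ^+ K ^+ (n %/ K) * (1 - d) ^+ (n %% K).
  by rewrite -exprM -exprD mulnC -divn_eq.
apply: ler_pM; rewrite ?exprn_ge0 //; try lra.
  by apply: lerXn2r; rewrite ?nnegrE ?exprn_ge0 //; lra.
by apply: ler_wiXn2l; [lra|lra|rewrite ltnW // ltn_mod].
Qed.

End Asymptotics.

(** * Large alphabets *)

Section Limit.

Variables (R : realType) (m : nat) (S : {set 'S_m.+1}).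

Definition density n : R := (alpha n S)%:R / n`!%:R.

Variable q : nat.
Hypothesis q_gt0 : (0 < q)%N.

(** Alphabet sizes run through the multiples of [q], to be divisible into [q] equal cells; the
    predecessor is there because [num_valid] takes the largest letter. *)
Definition word_density k n : R :=
  (num_valid (q * k.+1).-1 S n)%:R / (q * k.+1)%:R ^+ n.

Lemma alphabet_gt0 k : 0 < (q * k.+1)%:R :> R.
Proof. by rewrite ltr0n muln_gt0 q_gt0. Qed.

Lemma ffact_density_cvg n :
  (fun k => ((q * k.+1) ^_ n)%:R / (q * k.+1)%:R ^+ n : R) @ \oo --> (1 : R).
Proof.
elim: n => [|n IHn].
  by under eq_fun do rewrite ffactn0 expr0 divr1; exact: cvg_cst.
rewrite -[X in _ --> X]mulr1.
under eq_fun do rewrite ffactnSr natrM exprSr invfM mulrACA.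
apply: cvgM => //.
have low : (fun k => 1 - n%:R * k.+1%:R^-1 : R) @ \oo --> (1 : R).
  rewrite -[X in _ --> X]subr0; apply: cvgB; first exact: cvg_cst.
  by rewrite -(mulr0 n%:R); apply: cvgMr; exact: cvg_harmonic.
apply: (squeeze_cvgr (h := fun=> 1) _ low); [apply: nearW => k|exact: cvg_cst].
have X_gt0 := alphabet_gt0 k.
rewrite ler_pdivlMr // ler_pdivrMr // mul1r ler_nat leq_subr andbT.
have le1 : (q * k.+1)%:R - n%:R <= (q * k.+1 - n)%:R :> R.
  by rewrite lerBlDr -natrD ler_nat; lia.
apply: le_trans le1; rewrite mulrBl mul1r lerD2l lerN2 -mulrA ler_peMr //.
by rewrite mulrC ler_pdivlMr // mul1r ler_nat; nia.
Qed.

(** By [num_valid_alpha] the error is at most [1 - F k], the share of words with a repeated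
    letter. *)
Lemma word_density_cvg n : (fun k => word_density k n) @ \oo --> density n.
Proof.
pose F k : R := ((q * k.+1) ^_ n)%:R / (q * k.+1)%:R ^+ n.
have F1 : F @ \oo --> (1 : R) := ffact_density_cvg n.
have low : (fun k => density n * F k) @ \oo --> density n.
  by rewrite -[X in _ --> X]mulr1; apply: cvgMr.
have up : (fun k => density n * F k + (1 - F k)) @ \oo --> density n.
  rewrite -[X in _ --> X]addr0; apply: cvgD => //.
  by rewrite -(subrr 1); apply: cvgB => //; exact: cvg_cst.
apply: (squeeze_cvgr _ low up); apply: nearW => k.
have X_gt0 := alphabet_gt0 k; have Xn_gt0 := exprn_gt0 n X_gt0.
have f_gt0 : 0 < n`!%:R :> R by rewrite ltr0n fact_gt0.
have NE : ((q * k.+1).-1.+1 = q * k.+1)%N by rewrite prednK // muln_gt0 q_gt0.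
have := num_valid_alpha (q * k.+1).-1 n S; rewrite NE => /andP[le1 le2].
have le_ff : ((q * k.+1) ^_ n <= (q * k.+1) ^ n)%N.
  have := card_inj_ffuns 'I_n 'I_(q * k.+1); rewrite !card_ord => <-.
  by apply: leq_trans (max_card _) _; rewrite card_ffun !card_ord.
have fE : density n * F k =
    (alpha n S * (q * k.+1) ^_ n)%:R / (n`!%:R * (q * k.+1)%:R ^+ n).
  by rewrite /density /F natrM; field; rewrite -natrM !gt_eqF.
have vE : word_density k n =
    (num_valid (q * k.+1).-1 S n * n`!)%:R / (n`!%:R * (q * k.+1)%:R ^+ n).
  by rewrite /word_density natrM; field; rewrite -natrM !gt_eqF.
have FE : 1 - F k = (n`! * ((q * k.+1) ^ n - (q * k.+1) ^_ n))%:R /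
    (n`!%:R * (q * k.+1)%:R ^+ n).
  by rewrite /F [(n`! * _)%:R]natrM natrB // natrX; field; rewrite -?natrM !gt_eqF.
rewrite vE FE fE -mulrDl !ler_pM2r ?invr_gt0 ?mulr_gt0 // -natrD !ler_nat.
by rewrite le1.
Qed.

End Limit.

(** * Estimates for the limit densities *)

Section Estimates.

Variables (R : realType) (m : nat) (S : {set 'S_m.+1}).
Hypothesis m_gt0 : (0 < m)%N.
Hypothesis indecS : forall s, s \in S -> indecomposable s.
Hypothesis decrS : decreasing_perm m.+1 \notin S.

Local Notation a_ := (density R S).

Lemma density_ge n : (2 * m)%:R^-1 ^+ n <= a_ n.
Proof.
have q_gt0 : (0 < 2 * m)%N by rewrite muln_gt0.
have cst : (fun=> (2 * m)%:R^-1 ^+ n) @ \oo --> ((2 * m)%:R^-1 ^+ n : R).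
  exact: cvg_cst.
apply: (ler_cvg_to cst (@word_density_cvg R m S _ q_gt0 n)); apply: nearW => k.
have X_gt0 := alphabet_gt0 R q_gt0 k.
have NE : ((2 * m * k.+1).-1.+1 = 2 * m * k.+1)%N by rewrite prednK // muln_gt0 q_gt0.
(* Here [q = 2 * m], [l = 1] and each cell has [k.+1] letters. *)
have := num_valid_zigzag indecS decrS m_gt0 (leqnn _) NE (ltnSn 0) (esym (muln1 _)) n.
rewrite mul1n -(ler_nat R) natrX => leV.
rewrite /word_density ler_pdivlMr ?exprn_gt0 //.
by apply: le_trans leV; rewrite -exprMn [(2 * m * _)%:R]natrM mulKf // pnatr_eq0 -lt0n.
Qed.

Lemma density_gt0 n : 0 < a_ n.
Proof.
by apply: lt_le_trans (density_ge n); rewrite exprn_gt0 // invr_gt0 ltr0n muln_gt0.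
Qed.

(** The number of cells stays fixed while the cells grow, so the bounds of [num_valid_almost_swap],
    divided by [X ^+ (a.+1 + b)], do not depend on [k] and pass to the limit. *)
Lemma density_almost_swap l a b h :
  (0 < l)%N -> (2 * h * (6 * m) <= a)%N -> (2 * h * (6 * m) <= b)%N ->
  a_ a.+1 * a_ b <= a_ b.+1 * a_ a +
    ((1 - ((2 * m * l) ^ (8 * m))%:R^-1) ^+ h * (a_ a.+1 * a_ b) +
     2 ^+ (a.+1 + b) / l%:R ^+ h).
Proof.
move=> l_gt0 le_a le_b; set q := (2 * m * l)%N; set Q := (q ^ (8 * m))%N.
have q_gt0 : (0 < q)%N by rewrite !muln_gt0 m_gt0.
have Q_gt0 : (0 < Q)%N by rewrite expn_gt0 q_gt0.
have Qr_gt0 : 0 < Q%:R :> R by rewrite ltr0n.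
have lr_gt0 : 0 < l%:R :> R by rewrite ltr0n.
pose v k n : R := word_density R S q k n.
have vc n : v k n @[k --> \oo] --> a_ n := @word_density_cvg R m S _ q_gt0 n.
have lhs : v k a.+1 * v k b @[k --> \oo] --> a_ a.+1 * a_ b by apply: cvgM.
have rhs : v k b.+1 * v k a + ((1 - Q%:R^-1) ^+ h * (v k a.+1 * v k b) +
    2 ^+ (a.+1 + b) / l%:R ^+ h) @[k --> \oo] -->
    a_ b.+1 * a_ a + ((1 - Q%:R^-1) ^+ h * (a_ a.+1 * a_ b) +
    2 ^+ (a.+1 + b) / l%:R ^+ h).
  apply: cvgD; first by apply: cvgM.
  by apply: cvgD; [apply: cvgMr | exact: cvg_cst].
apply: (ler_cvg_to lhs rhs); apply: nearW => k.
have X_gt0 := alphabet_gt0 R q_gt0 k; set X := (q * k.+1)%:R in X_gt0.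
have NE : ((q * k.+1).-1.+1 = q * k.+1)%N by rewrite prednK // muln_gt0 q_gt0.
have le_q : (2 * m <= q)%N by rewrite leq_pmulr.
have [U [V [leUV leU leV]]] :=
  num_valid_almost_swap indecS decrS m_gt0 le_q NE l_gt0 erefl le_a le_b.
rewrite NE -/Q in leU leV.
rewrite /v /word_density -/X.
set A1 := (num_valid _ _ a.+1)%:R; set A0 := (num_valid _ _ a)%:R.
set B1 := (num_valid _ _ b.+1)%:R; set B0 := (num_valid _ _ b)%:R.
have {}leUV : A1 * B0 <= B1 * A0 + (U%:R + V%:R).
  by rewrite -!natrM -!natrD ler_nat.
have {}leU : U%:R * Q%:R ^+ h <= (Q%:R - 1) ^+ h * (A1 * B0).
  by rewrite -(natrB _ Q_gt0) subn1 -!natrX -!natrM ler_nat.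
have {}leV : V%:R * l%:R ^+ h <= (2 * X) ^+ (a.+1 + b).
  by rewrite -natrM -!natrX -natrM ler_nat.
have XE n1 n2 (c d : R) : c / X ^+ n1 * (d / X ^+ n2) = c * d / X ^+ (n1 + n2).
  by rewrite exprD invfM mulrACA.
rewrite !XE (_ : b.+1 + a = a.+1 + b)%N; last lia.
set Y := X ^+ (a.+1 + b); have Y_gt0 : 0 < Y by rewrite exprn_gt0.
rewrite mulrA; have -> : 2 ^+ (a.+1 + b) / l%:R ^+ h =
    (2 * X) ^+ (a.+1 + b) / l%:R ^+ h / Y.
  by rewrite exprMn -/Y mulrAC mulfK // gt_eqF.
rewrite -!mulrDl ler_pM2r ?invr_gt0 //; apply: le_trans leUV _.
rewrite lerD2l lerD //.
  have -> : (1 - Q%:R^-1) = (Q%:R - 1) / Q%:R :> R.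
    by rewrite mulrBl divff ?gt_eqF // mul1r.
  by rewrite expr_div_n mulrAC ler_pdivlMr ?exprn_gt0.
by rewrite ler_pdivlMr ?exprn_gt0.
Qed.

Lemma density_geometric_swap : exists C t : R, [/\ 0 <= C, 0 < t < 1 &
  forall a b n, (n <= a)%N -> (n <= b)%N -> (a.+1 + b = 2 * n.+1)%N ->
    a_ a.+1 * a_ b <= a_ b.+1 * a_ a + C * t ^+ n * (a_ a.+1 * a_ b)].
Proof.
(* With this [l], [2 ^ (2 * n) / l ^ (n / K)] is, up to a constant, at most
   [2 ^ - n] times the lower bound [(2 * m) ^ - (2 * n)] from [density_ge]. *)
pose A := (2 * (4 * m) ^ 2)%N; pose K := (12 * m)%N; pose l := (A ^ K)%N.
have A_gt0 : (0 < A)%N by rewrite muln_gt0 expn_gt0 muln_gt0 m_gt0.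
have l_gt0 : (0 < l)%N by rewrite expn_gt0 A_gt0.
have K_gt0 : (0 < K)%N by rewrite muln_gt0 m_gt0.
pose Q := ((2 * m * l) ^ (8 * m))%N.
have Q_gt0 : (0 < Q)%N by rewrite expn_gt0 !muln_gt0 m_gt0 l_gt0.
pose cr : R := 1 - Q%:R^-1.
have cQ : 0 <= cr < 1.
  rewrite /cr subr_ge0 invf_le1 ?ltr0n // ler1n Q_gt0 /=.
  by rewrite gtrBl invr_gt0 ltr0n.
have [C1 [t1 [C1_ge0 /andP[t1_gt0 t1_lt1] le_t1]]] := expr_divn_le cQ K_gt0.
(* The factor [(4 * m) ^ 2] pays for the exponent [2 * n.+1] instead of [2 * n], and [l] for the
   rounding in [n %/ K]. *)
pose D : R := ((4 * m) ^ 2 * l)%:R.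
pose t := Num.max t1 2^-1.
have t_gt0 : 0 < t by rewrite lt_max t1_gt0.
have t1_le : t1 <= t by rewrite le_max lexx.
have half_le : 2^-1 <= t by rewrite le_max lexx orbT.
exists (C1 + D), t; split; first by rewrite addr_ge0.
  by rewrite t_gt0 gt_max t1_lt1 /=; lra.
(* Since [K = 12 * m], the [2 * h] blocks of length [6 * m] fit into [n] letters. *)
move=> a b n le_na le_nb abE; set h := (n %/ K)%N.
have le_h : (2 * h * (6 * m) <= n)%N.
  have -> : (2 * h * (6 * m) = h * K)%N by rewrite /K; lia.
  exact: leq_divM.
have le1 := density_almost_swap l_gt0 (leq_trans le_h le_na) (leq_trans le_h le_nb).
apply: le_trans le1 _; rewrite lerD2l -/Q.
have P_gt0 : 0 < a_ a.+1 * a_ b by rewrite mulr_gt0 ?density_gt0.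
rewrite !mulrDl lerD //.
  rewrite ler_pM2r //; apply: le_trans (le_t1 n) _.
  by rewrite ler_wpM2l // lerXn2r ?nnegrE ?(ltW t1_gt0) ?(ltW t_gt0).
rewrite ler_pdivrMr ?exprn_gt0 ?ltr0n //.
have P_ge : (2 * m)%:R^-1 ^+ (2 * n.+1) <= a_ a.+1 * a_ b.
  rewrite -abE exprD; apply: ler_pM; [| |exact: density_ge|exact: density_ge];
    by rewrite exprn_ge0 ?invr_ge0.
have t_ge : 2^-1 ^+ n <= t ^+ n.
  by rewrite lerXn2r ?nnegrE ?invr_ge0 // (ltW t_gt0).
have lowb : 2^-1 ^+ n * (2 * m)%:R^-1 ^+ (2 * n.+1) <= t ^+ n * (a_ a.+1 * a_ b).
  by apply: ler_pM => //; rewrite exprn_ge0 ?invr_ge0.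
have D_ge0 : 0 <= D by [].
have lh_ge0 : 0 <= l%:R ^+ h :> R by rewrite exprn_ge0.
have := ler_wpM2r lh_ge0 (ler_wpM2l D_ge0 lowb); rewrite [X in _ <= X](_ : _ =
  D * t ^+ n * (a_ a.+1 * a_ b) * l%:R ^+ h); last by rewrite !mulrA.
apply: le_trans.
have m2_gt0 : 0 < (2 * m)%:R :> R by rewrite ltr0n muln_gt0.
rewrite abE !exprVn -invfM mulrAC ler_pdivlMr ?mulr_gt0 ?exprn_gt0 //.
rewrite /D -!(natrX, natrM) ler_nat.
rewrite -mulnA -expnS.
have le_Kn : (A ^ n <= l ^ h.+1)%N.
  by rewrite -expnM leq_pexp2l // ltnW // mulnC ltn_ceil.
apply: leq_trans (leq_mul (leqnn _) le_Kn).
rewrite mulnCA -expnMn mulnA -[(2 * 2)%N]/4%N expnM.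
by rewrite [(_ ^ n.+1)%N]expnS mulnCA -expnMn.
Qed.

End Estimates.

Theorem theorem1p5 (R : realType) (m : nat) (S : {set 'S_(m.+1)}) :
  (2 <= m)%N ->
  (forall s : 'S_(m.+1), s \in S -> indecomposable s) ->
  decreasing_perm m.+1 \notin S ->
  exists c lambda r : R,
    [/\ 0 < c, 0 < lambda, 0 < r, r < lambda &
      (fun n : nat => (alpha n S)%:R / (n`!)%:R : R) =
        (fun n : nat => c * lambda ^+ n : R) +O_\oo (fun n : nat => r ^+ n)].
Proof.
move=> /ltnW m_gt0 indecS decrS.
have [C [t [C_ge0 /[dup] t01 /andP[t_gt0 t_lt1] swap_le]]] :=
  density_geometric_swap R m_gt0 indecS decrS.
have s_gt0 := density_gt0 R m_gt0 indecS decrS.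
have [c [lambda [c_gt0 lambda_gt0 [n0 [K le_K]]]]] :
    exists c lambda : R, [/\ 0 < c, 0 < lambda &
      exists n0 K, forall n, (n0 <= n)%N ->
        `|density R S n - c * lambda ^+ n| <= K * (lambda * t) ^+ n].
  (* The two required inequalities are the exchanges with [(a, b)] equal to [(n.+1, n)] and to
     [(n, n.+1)]. *)
  apply: log_linear_asymptotics C_ge0 t01 s_gt0 _ _ => n; rewrite expr2.
    by apply: swap_le; lia.
  have := swap_le n n.+1 n (leqnn _) (leqnSn _); apply; lia.
exists c, lambda, (lambda * t); split; rewrite ?mulr_gt0 //.
  by rewrite gtr_pMr.
apply/eqaddOP; exists K; split; first exact: num_real.
move=> k lt_Kk; exists n0 => // n /= le_n.
apply: le_trans (le_K n le_n) _.
have r_ge0 : 0 <= (lambda * t) ^+ n by rewrite exprn_ge0 // mulr_ge0 ?ltW.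
by rewrite ger0_norm // ler_wpM2r // ltW.
Qed.
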